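(* Let $X$ be a set. The wire $F_w(X)$ defined in the context is the free wire generated by the set $X$. Explicitly, for each wire $W$ and each map $f\colon X\to W$, there exists a unique wire morphism $\hat f\colon F_w(X)\to W$ such that $\hat f\iota=f$, where $\iota\colon X\to F_w(X)$ is the canonical injection.
   Context: A wire is a triple $(W,\star,\circ)$ with $(W,\star)$ a group, $(W,\circ)$ a semigroup, and $a\circ(b\star c)=(a\circ b)\star a^{-1}\star(a\circ c)$, $(b\star c)\circ a=(b\circ a)\star a^{-1}\star(c\circ a)$ for all $a,b,c\in W$, where $a^{-1}$ is the inverse with respect to $\star$. A wire morphism is a map preserving $\star$ and $\circ$. Construction of $F_w(X)$. Let $M(X)$ be the free semigroup (without identity) generated by $X$, with operation $\circ$, and let $P(X)$ be the free group generated by the set $M(X)$, with operation $\star$ and neutral element $e$. Write elements of $P(X)$ as $u=\prod_{i=1}^n u_i^{\epsilon_i}=u_1^{\epsilon_1}\star\cdots\star u_n^{\epsilon_n}$ with $u_i\in M(X)$, $\epsilon_i\in\{1,-1\}$ (ordered product, not necessarily reduced). For $l\in M(X)$ put $$l\circ u=l\star\prod_{i=1}^n\bigl(l^{-1}\star(l\circ u_i)\bigr)^{\epsilon_i},\qquad u\circ l=\Bigl(\prod_{i=1}^n\bigl((u_i\circ l)\star l^{-1}\bigr)^{\epsilon_i}\Bigr)\star l.$$ For $u=\prod_{i=1}^n u_i^{\epsilon_i}$ and $v=\prod_{j=1}^m v_j^{\delta_j}$ in $P(X)$ put $$u\circ_r v=\Bigl(\prod_{i=1}^n\bigl((u_i\circ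 v)\star v^{-1}\bigr)^{\epsilon_i}\Bigr)\star v,\qquad u\circ_l v=u\star\prod_{j=1}^m\bigl(u^{-1}\star(u\circ v_j)\bigr)^{\delta_j}.$$ None of these depends on the chosen word representatives. Let $P(X)^2$ (respectively $P(X)^2_{\mathrm{op}}$) be the normal subgroup of $P(X)$ generated by the elements $m^{-1}\star(m\circ l)\star l^{-1}$ (respectively $m^{-1}\star(l\circ m)\star l^{-1}$) for $m,l\in M(X)$, and let $[P(X)^2,P(X)^2_{\mathrm{op}}]$ be the subgroup generated by the commutators $a\star b\star a^{-1}\star b^{-1}$ with $a\in P(X)^2$, $b\in P(X)^2_{\mathrm{op}}$. Then $F_w(X)=P(X)/[P(X)^2,P(X)^2_{\mathrm{op}}]$, with the induced $\star$ and with $[u]\circ[v]=[u\circ_l v]=[u\circ_r v]$ (these two classes coincide and the operation is well defined, making $F_w(X)$ a wire). The map $\iota$ sends $x\in X$ to the class of $x\in M(X)\subset P(X)$. *)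

(* Defs.v *)
From HB Require Import structures.
From mathcomp Require Import all_boot boolp classical_sets.

Set Implicit Arguments.
Unset Strict Implicit.
Unset Printing Implicit Defensive.

Local Open Scope classical_set_scope.
Local Open Scope group_scope.
Local Open Scope quotient_scope.

(* The group operation, written [\star] on paper, is the product [x * y] of
   [groupType]. *)
HB.mixin Record Group_isWire W of Group W := {
  circ : W -> W -> W;
  circA : associative circ;
  circMr : forall a b c : W, circ a (b * c) = circ a b * a^-1 * circ a c;
  circMl : forall a b c : W, circ (b * c) a = circ b a * a^-1 * circ c a
}.

#[short(type="wireType")]
HB.structure Definition Wire := {W of Group_isWire W & Group W}.

Bind Scope group_scope with Wire.sort.

Notation "a \circ b" := (circ a b) (at level 40, left associativity) :
  group_scope.

Definition wire_morphism (V W : wireType) (f : V -> W) : Prop :=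
  {morph f : a b / a * b} /\ {morph f : a b / a \circ b}.

Section Subgroups.
Variable G : groupType.
Implicit Types (x y : G) (A B N : set G).

Definition is_subgroup A : Prop :=
  [/\ A 1, forall x y, A x -> A y -> A (x * y) & forall x, A x -> A x^-1].

Definition is_normal_subgroup A : Prop :=
  is_subgroup A /\ forall x y, A x -> A (x ^ y).

Definition generated A : set G := smallest is_subgroup A.

Definition normal_closure A : set G := smallest is_normal_subgroup A.

Definition commutator_subgroup A B : set G :=
  generated [set x | exists2 a, A a & exists2 b, B b & x = a * b * a^-1 * b^-1].

Lemma generated_subgroup A : is_subgroup (generated A).
Proof.
split.
- by move=> B [[B1 _ _] _].
- move=> x y Ax Ay B BP; case: (BP) => -[_ BM _] _.
  by apply: BM; [apply: Ax|apply: Ay].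
- by move=> x Ax B BP; case: (BP) => -[_ _ BV] _; apply: BV; apply: Ax.
Qed.

Lemma normal_closure_normal A : is_normal_subgroup (normal_closure A).
Proof.
split; first split.
- by move=> B [[[B1 _ _] _] _].
- move=> x y Ax Ay B BP; case: (BP) => -[[_ BM _] _] _.
  by apply: BM; [apply: Ax|apply: Ay].
- by move=> x Ax B BP; case: (BP) => -[[_ _ BV] _] _; apply: BV; apply: Ax.
- by move=> x y Ax B BP; case: (BP) => -[_ BJ] _; apply: BJ; apply: Ax.
Qed.

Lemma commutator_subgroup_normal A B : is_normal_subgroup A ->
  is_normal_subgroup B -> is_normal_subgroup (commutator_subgroup A B).
Proof.
move=> [_ nA] [_ nB]; split; first exact: generated_subgroup.
move=> x y; move: x; apply: smallest_sub.
  have [C1 CM CV] := generated_subgroup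
    [set x | exists2 a, A a & exists2 b, B b & x = a * b * a^-1 * b^-1].
  split=> [|x z /= Cx Cz|x /= Cx].
  - by rewrite /= conj1g.
  - by rewrite conjMg; apply: CM.
  - by rewrite conjVg; apply: CV.
move=> _ [a Aa [b Bb ->]] /=; apply: sub_gen_smallest.
exists (a ^ y); first exact: nA.
by exists (b ^ y); [apply: nB|rewrite !conjMg !conjVg].
Qed.

End Subgroups.

Record normal_subgroup (G : groupType) := NormalSubgroup {
  normal_set : set G;
  normal_setP : is_normal_subgroup normal_set
}.

Section Quotient.
Variables (G : groupType) (N : normal_subgroup G).
Implicit Types x y z : G.

Definition congr_rel : rel G := fun x y => `[< normal_set N (x^-1 * y) >].

Lemma congr_rel_refl : reflexive congr_rel.
Proof. by move=> x; apply/asboolP; rewrite mulVg; case: (normal_setP N) => -[]. Qed.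

Lemma congr_rel_sym : symmetric congr_rel.
Proof.
have [[_ _ NV] _] := normal_setP N.
have H x y : congr_rel x y -> congr_rel y x.
  by move=> /asboolP/NV Nxy; apply/asboolP; rewrite invgM invgK in Nxy.
by move=> x y; apply/idP/idP => /H.
Qed.

Lemma congr_rel_trans : transitive congr_rel.
Proof.
have [[_ NM _] _] := normal_setP N.
move=> y x z /asboolP Nxy /asboolP Nyz; apply/asboolP.
have -> : x^-1 * z = x^-1 * y * (y^-1 * z) by rewrite !gnorm.
exact: NM.
Qed.

Canonical congr_equiv :=
  EquivRel congr_rel congr_rel_refl congr_rel_sym congr_rel_trans.

Definition quot : Type := {eq_quot congr_equiv}.

HB.instance Definition _ := EqQuotient.on quot.
HB.instance Definition _ := Choice.on quot.

Definition cls (x : G) : quot := \pi_quot x.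

Lemma clsP x y : cls x = cls y <-> normal_set N (x^-1 * y).
Proof. by split => [/eqquotP/asboolP|H]//; apply/eqquotP/asboolP. Qed.

Lemma cls_repr (q : quot) : cls (repr q) = q.
Proof. exact: reprK. Qed.

Lemma quot_ind (P : quot -> Prop) : (forall x, P (cls x)) -> forall q, P q.
Proof. by move=> PH q; rewrite -(cls_repr q). Qed.

Lemma cls_mul x x' y y' : cls x = cls x' -> cls y = cls y' ->
  cls (x * y) = cls (x' * y').
Proof.
have [[_ NM _] NJ] := normal_setP N.
move=> /clsP Nx /clsP Ny; apply/clsP.
rewrite (_ : _ * _ = (x^-1 * x') ^ y * (y^-1 * y')); first by apply: NM => //; apply: NJ.
by rewrite /conjg !gnorm.
Qed.

Lemma cls_inv x x' : cls x = cls x' -> cls x^-1 = cls x'^-1.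
Proof.
have [[_ NM NV] NJ] := normal_setP N.
move=> /clsP Nx; apply/clsP.
rewrite (_ : _ * _ = (x^-1 * x')^-1 ^ x^-1); first by apply: NJ; apply: NV.
by rewrite /conjg !gnorm.
Qed.

Definition qmul (p q : quot) : quot := cls (repr p * repr q).
Definition qone : quot := cls 1.
Definition qinv (q : quot) : quot := cls (repr q)^-1.

Lemma qmulE x y : qmul (cls x) (cls y) = cls (x * y).
Proof. by apply: cls_mul; rewrite cls_repr. Qed.

Lemma qinvE x : qinv (cls x) = cls x^-1.
Proof. by apply: cls_inv; rewrite cls_repr. Qed.

Lemma qmulA : associative qmul.
Proof.
by elim/quot_ind=> x; elim/quot_ind=> y; elim/quot_ind=> z; rewrite !qmulE mulgA.
Qed.

Lemma qmul1 : left_id qone qmul.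
Proof. by elim/quot_ind=> x; rewrite qmulE mul1g. Qed.

Lemma qmulr1 : right_id qone qmul.
Proof. by elim/quot_ind=> x; rewrite qmulE mulg1. Qed.

Lemma qmulV : left_inverse qone qinv qmul.
Proof. by elim/quot_ind=> x; rewrite qinvE qmulE mulVg. Qed.

Lemma qmulrV : right_inverse qone qinv qmul.
Proof. by elim/quot_ind=> x; rewrite qinvE qmulE mulgV. Qed.

HB.instance Definition _ := isGroup.Build quot qmulA qmul1 qmulr1 qmulV qmulrV.

Lemma clsM : {morph cls : x y / x * y}.
Proof. by move=> x y; rewrite -qmulE. Qed.

Lemma clsV : {morph cls : x / x^-1}.
Proof. by move=> x; rewrite -qinvE. Qed.

End Quotient.

Arguments cls {G} N x.

(* Nonempty words, represented by their first letter and the list of the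
   remaining ones; [X] is an arbitrary type, so that decidable equality and the
   choice operator on words come from the classical axioms. *)
Record free_semigroup (X : Type) := Word { first_letter : X; tail : seq X }.

HB.instance Definition _ (X : Type) := gen_eqMixin (free_semigroup X).
HB.instance Definition _ (X : Type) := gen_choiceMixin (free_semigroup X).

Definition letter (X : Type) (x : X) : free_semigroup X := Word x [::].

Definition word_cat (X : Type) (m l : free_semigroup X) : free_semigroup X :=
  Word (first_letter m) (tail m ++ first_letter l :: tail l).

Lemma word_catA (X : Type) : associative (@word_cat X).
Proof. by move=> [x s] [y t] [z r]; rewrite /word_cat /= -catA. Qed.

HB.instance Definition _ (X : Type) :=
  isSemigroup.Build (free_semigroup X) (@word_catA X).

(* The free group on [T] is the set of reduced words in the letters
   [(t, true)], standing for [t], and [(t, false)], standing for [t^-1]. *)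

Section FreeGroup.
Variable T : choiceType.
Implicit Types (a b : T * bool) (s : seq (T * bool)).

Definition flip a : T * bool := (a.1, ~~ a.2).

Definition reduced s : bool := sorted (fun a b => b != flip a) s.

Record free_group := FreeGroup {
  red_word :> seq (T * bool);
  red_wordP : reduced red_word
}.

HB.instance Definition _ := [isSub for red_word].
HB.instance Definition _ := [Choice of free_group by <:].

Definition push a s : seq (T * bool) :=
  if s is b :: s' then if b == flip a then s' else a :: s else [:: a].

Definition reduce s : seq (T * bool) := foldr push [::] s.

Lemma flipK : involutive flip.
Proof. by case=> t e; rewrite /flip /= negbK. Qed.

Lemma push_reduced a s : reduced s -> reduced (push a s).
Proof.
case: s => [|b s] //= sP; case: ifPn => [_|nab]; last by rewrite /reduced /= nab.
exact: path_sorted sP.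
Qed.

Lemma reduce_reduced s : reduced (reduce s).
Proof. by elim: s => //= a s; apply: push_reduced. Qed.

Lemma pushK a s : reduced s -> push (flip a) (push a s) = s.
Proof.
case: s => [|b s] /=; first by rewrite flipK eqxx.
case: (b =P flip a) => [->|_] sP; last by rewrite /= flipK eqxx.
case: s sP => [|c s] //= /andP[ncb _]; rewrite flipK in ncb.
by rewrite flipK (negPf ncb).
Qed.

Lemma reduce_id s : reduced s -> reduce s = s.
Proof.
elim: s => //= a s IHs sP; rewrite IHs; last exact: path_sorted sP.
by case: s sP {IHs} => [|b s] //= /andP[/negPf ->].
Qed.

Lemma foldr_push_reduced s t : reduced t -> reduced (foldr push t s).
Proof. by move=> tP; elim: s => //= a s; apply: push_reduced. Qed.

Lemma foldr_push a s t : reduced t -> reduced s ->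
  foldr push t (push a s) = push a (foldr push t s).
Proof.
move=> tP; case: s => [|b s] //= sP; case: eqP => [->|_] //=.
have /(pushK (flip a)) := foldr_push_reduced s tP.
by rewrite flipK.
Qed.

Lemma foldr_reduce s t : reduced t -> foldr push t (reduce s) = foldr push t s.
Proof.
move=> tP; elim: s => //= a s IHs.
by rewrite foldr_push ?IHs //; apply: reduce_reduced.
Qed.

Definition mkfg s : free_group := FreeGroup (reduce_reduced s).

Definition fg_mul (u v : free_group) : free_group := mkfg (u ++ v).
Definition fg_one : free_group := mkfg [::].
Definition fg_inv (u : free_group) : free_group := mkfg (rev (map flip u)).

Lemma reduce_catl s t : reduce (reduce s ++ t) = reduce (s ++ t).
Proof. by rewrite /reduce !foldr_cat foldr_reduce //; apply: reduce_reduced. Qed.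

Lemma reduce_catr s t : reduce (s ++ reduce t) = reduce (s ++ t).
Proof. by rewrite /reduce !foldr_cat [X in foldr _ X _](reduce_id (reduce_reduced t)). Qed.

Lemma fg_mulA : associative fg_mul.
Proof. by move=> u v w; apply: val_inj; rewrite /= reduce_catl reduce_catr catA. Qed.

Lemma fg_mul1 : left_id fg_one fg_mul.
Proof. by move=> u; apply: val_inj; rewrite /= reduce_id //; apply: red_wordP. Qed.

Lemma fg_mulr1 : right_id fg_one fg_mul.
Proof. by move=> u; apply: val_inj; rewrite /= cats0 reduce_id //; apply: red_wordP. Qed.

Lemma reduce_catV s : reduce (rev (map flip s) ++ s) = [::].
Proof.
elim: s => //= a s IHs; rewrite rev_cons cat_rcons -reduce_catr /=.
by rewrite pushK ?reduce_catr //; apply: reduce_reduced.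
Qed.

Lemma fg_mulV : left_inverse fg_one fg_inv fg_mul.
Proof. by move=> u; apply: val_inj; rewrite /= reduce_catl reduce_catV. Qed.

Lemma fg_mulrV : right_inverse fg_one fg_inv fg_mul.
Proof.
move=> u; apply: val_inj; rewrite /= reduce_catr.
rewrite -[X in X ++ _](mapK flipK) -[X in X ++ _]revK -map_rev.
exact: reduce_catV.
Qed.

HB.instance Definition _ :=
  isGroup.Build free_group fg_mulA fg_mul1 fg_mulr1 fg_mulV fg_mulrV.

Definition gen (t : T) : free_group := mkfg [:: (t, true)].

Section Lift.
Variables (G : groupType) (f : T -> G).

Definition signed a : G := if a.2 then f a.1 else (f a.1)^-1.

(* [\prod_i f(u_i) ^ e_i] for [u = \prod_i u_i ^ e_i]. The reduced word of [u]
   is used here; [fg_lift_word] states independence from the word. *)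
Definition fg_lift (u : free_group) : G := \big[*%g/1]_(a <- red_word u) signed a.

Lemma signed_flip a : signed a * signed (flip a) = 1.
Proof. by case: a => t [] /=; rewrite /signed /= ?mulgV ?mulVg. Qed.

Lemma prod_reduce s :
  \big[*%g/1]_(a <- reduce s) signed a = \big[*%g/1]_(a <- s) signed a.
Proof.
elim: s => //= a s IHs; rewrite big_cons -IHs.
case: (reduce s) => [|b t] /=; first by rewrite big_cons.
by case: eqP => [->|_]; rewrite !big_cons // mulgA signed_flip mul1g.
Qed.

Lemma fg_liftM : {morph fg_lift : u v / u * v}.
Proof. by move=> u v; rewrite /fg_lift /= prod_reduce big_cat. Qed.

Lemma fg_lift_gen t : fg_lift (gen t) = f t.
Proof. by rewrite /fg_lift /= big_seq1. Qed.

End Lift.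

Lemma fg_ind (P : free_group -> Prop) : P 1 ->
  (forall t u, P u -> P (gen t * u)) -> (forall t u, P u -> P ((gen t)^-1 * u)) ->
  forall u, P u.
Proof.
move=> P1 Pg PV u.
have -> : u = mkfg u.
    by apply: val_inj; rewrite /= reduce_id //; apply: red_wordP.
elim: {u}(red_word u) => [|[t e] s IHs]; first exact: P1.
have -> : mkfg ((t, e) :: s) = mkfg [:: (t, e)] * mkfg s.
  by apply: val_inj; rewrite /= (reduce_id (reduce_reduced s)).
by case: e; [exact: Pg|exact: PV].
Qed.

Lemma morph1V (G H : groupType) (f : G -> H) : {morph f : x y / x * y} ->
  f 1 = 1 /\ {morph f : x / x^-1}.
Proof.
move=> fM; have f1 : f 1 = 1.
  by apply: (mulgI (f 1)); rewrite -fM !mulg1.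
split=> // x; apply: (mulgI (f x)); by rewrite -fM !mulgV.
Qed.

Lemma fg_ext (G : groupType) (f g : free_group -> G) :
  {morph f : x y / x * y} -> {morph g : x y / x * y} ->
  (forall t, f (gen t) = g (gen t)) -> f =1 g.
Proof.
move=> fM gM fg; have [f1 fV] := morph1V fM; have [g1 gV] := morph1V gM.
apply: fg_ind => [|t u fgu|t u fgu]; first by rewrite f1.
  by rewrite fM gM fg fgu.
by rewrite fM gM fV gV fg fgu.
Qed.

Lemma fg_lift_word (G : groupType) (f : T -> G) s :
  fg_lift f (\big[*%g/1]_(a <- s) signed gen a) = \big[*%g/1]_(a <- s) signed f a.
Proof.
have [f1 fV] := morph1V (fg_liftM f).
rewrite (big_morph _ (fg_liftM f) f1); apply: eq_bigr => -[t []] _.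
  exact: fg_lift_gen.
by rewrite /signed /= fV fg_lift_gen.
Qed.

End FreeGroup.

Section FreeWire.
Variable X : Type.

Local Notation M := (free_semigroup X).
Local Notation P := (free_group M).
Implicit Types (l m : M) (u v w : P).

(* For [l m : M], the product [l * m] is the operation of the semigroup [M],
   written [l \circ m] on paper. [circ_Ml l u] is [l \circ u] and [circ_Mr u l]
   is [u \circ l], for [l : M] and [u : P]. *)
Definition circ_Ml l u : P :=
  gen l * fg_lift (fun m => (gen l)^-1 * gen (l * m)) u.
Definition circ_Mr u l : P :=
  fg_lift (fun m => gen (m * l) * (gen l)^-1) u * gen l.

Definition circ_r u v : P := fg_lift (fun m => circ_Ml m v * v^-1) u * v.
Definition circ_l u v : P := u * fg_lift (fun m => u^-1 * circ_Mr u m) v.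

Definition P2 : set P :=
  normal_closure [set x | exists m l, x = (gen m)^-1 * gen (m * l) * (gen l)^-1].
Definition P2op : set P :=
  normal_closure [set x | exists m l, x = (gen m)^-1 * gen (l * m) * (gen l)^-1].

Definition P2_comm : normal_subgroup P :=
  NormalSubgroup (commutator_subgroup_normal
    (normal_closure_normal _ : is_normal_subgroup P2)
    (normal_closure_normal _ : is_normal_subgroup P2op)).

Definition Fw : Type := quot P2_comm.

HB.instance Definition _ := Group.on Fw.

Definition fw_class (u : P) : Fw := cls P2_comm u.

Definition fw_iota (x : X) : Fw := fw_class (gen (letter x)).

(* Independent of the representatives, and computable with [circ_r] as well:
   see [fw_circE] and [fw_circEr]. *)
Definition fw_circ (p q : Fw) : Fw := fw_class (circ_l (repr p) (repr q)).

Local Notation N1 :=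
  (NormalSubgroup (normal_closure_normal _ : is_normal_subgroup P2)).
Local Notation N2 :=
  (NormalSubgroup (normal_closure_normal _ : is_normal_subgroup P2op)).
Local Notation pi := fw_class.

Let El u : P -> P := fg_lift (fun m => u^-1 * circ_Mr u m).
Let Er v : P -> P := fg_lift (fun m => circ_Ml m v * v^-1).

Let ElM u : {morph El u : x y / x * y}. Proof. exact: fg_liftM. Qed.
Let ErM u : {morph Er u : x y / x * y}. Proof. exact: fg_liftM. Qed.

Let piM : {morph pi : x y / x * y}. Proof. exact: clsM. Qed.
Let piV : {morph pi : x / x^-1}. Proof. exact: clsV. Qed.
Let pi_ind (Q : Fw -> Prop) : (forall x, Q (pi x)) -> forall q, Q q.
Proof. exact: quot_ind. Qed.

Lemma cls1_gen m l : cls N1 (gen (m * l)) = cls N1 (gen m) * cls N1 (gen l).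
Proof.
rewrite -clsM; apply/esym/clsP.
have [_ NJ] := normal_setP N1.
rewrite (_ : _ * _ = ((gen m)^-1 * gen (m * l) * (gen l)^-1) ^ gen l).
  by apply: NJ; apply: sub_gen_smallest; exists m, l.
by rewrite /conjg !gnorm.
Qed.

Lemma cls2_gen m l : cls N2 (gen (m * l)) = cls N2 (gen l) * cls N2 (gen m).
Proof.
rewrite -clsM; apply/esym/clsP.
have [_ NJ] := normal_setP N2.
rewrite (_ : _ * _ = ((gen l)^-1 * gen (m * l) * (gen m)^-1) ^ gen m).
  by apply: NJ; apply: sub_gen_smallest; exists l, m.
by rewrite /conjg !gnorm.
Qed.

Lemma cls1_Mr u m : cls N1 (circ_Mr u m) = cls N1 u * cls N1 (gen m).
Proof.
rewrite clsM; congr (_ * _); move: u.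
apply: fg_ext => [u v|u v|l]; rewrite ?fg_liftM ?clsM //.
by rewrite fg_lift_gen clsM cls1_gen clsV !gnorm.
Qed.

Lemma cls2_Mr u m : cls N2 (circ_Mr u m) = cls N2 (gen m) * cls N2 u.
Proof.
rewrite clsM; apply: (mulIg (cls N2 (gen m))^-1); rewrite mulgK; move: u.
apply: fg_ext => [u v|u v|l]; rewrite ?fg_liftM ?clsM //; first by rewrite !gnorm.
by rewrite fg_lift_gen clsM cls2_gen clsV.
Qed.

Lemma cls1_El u v : cls N1 (El u v) = cls N1 v.
Proof.
move: v; apply: fg_ext => [v w|v w|l]; rewrite ?ElM ?clsM //.
by rewrite /El fg_lift_gen clsM cls1_Mr clsV !gnorm.
Qed.

Lemma cls2_El u v : cls N2 (El u v) = cls N2 v ^ cls N2 u.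
Proof.
move: v; apply: fg_ext => [v w|v w|l]; rewrite ?ElM ?clsM ?conjMg //.
by rewrite /El fg_lift_gen clsM cls2_Mr clsV.
Qed.

Lemma cls1_Ml m v : cls N1 (circ_Ml m v) = cls N1 (gen m) * cls N1 v.
Proof.
rewrite clsM; congr (_ * _); move: v.
apply: fg_ext => [u v|u v|l]; rewrite ?fg_liftM ?clsM //.
by rewrite fg_lift_gen clsM cls1_gen clsV !gnorm.
Qed.

Lemma cls2_Ml m v : cls N2 (circ_Ml m v) = cls N2 v * cls N2 (gen m).
Proof.
rewrite clsM; apply: (mulgI (cls N2 (gen m))^-1); rewrite mulKg.
move: v; apply: fg_ext => [u v|u v|l]; rewrite ?fg_liftM ?clsM //; first by rewrite !gnorm.
by rewrite fg_lift_gen clsM cls2_gen clsV.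
Qed.

Lemma cls1_Er u v : cls N1 (Er v u) = cls N1 u.
Proof.
move: u; apply: fg_ext => [u w|u w|l]; rewrite ?ErM ?clsM //.
by rewrite /Er fg_lift_gen clsM cls1_Ml clsV !gnorm.
Qed.

Lemma cls2_Er u v : cls N2 (Er v u) = cls N2 u ^ (cls N2 v)^-1.
Proof.
move: u; apply: fg_ext => [u w|u w|l]; rewrite ?ErM ?clsM ?conjMg //.
by rewrite /Er fg_lift_gen clsM cls2_Ml clsV /conjg !gnorm.
Qed.

Lemma cls_eq1 (N : normal_subgroup P) u : cls N u = 1 <-> normal_set N u.
Proof.
rewrite -[1]/(cls N 1); split=> [/esym/clsP|Nu]; first by rewrite invg1 mul1g.
by apply/esym/clsP; rewrite invg1 mul1g.
Qed.

Lemma pi_commute u v : cls N1 u = 1 -> cls N2 v = 1 -> pi u * pi v = pi v * pi u.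
Proof.
move=> /cls_eq1 N1u /cls_eq1 N2v.
have : pi (u * v * u^-1 * v^-1) = 1.
  by apply/cls_eq1; apply: sub_gen_smallest; exists u => //; exists v.
rewrite !piM !piV => uv1.
by apply: (mulIg (pi u)^-1); apply: (mulIg (pi v)^-1); rewrite uv1 !gnorm.
Qed.

Lemma comm_sub_morph (f : P -> P) : {morph f : x y / x * y} ->
    (forall u, P2 u -> P2 (f u)) -> (forall u, P2op u -> P2op (f u)) ->
  forall u v, pi u = pi v -> pi (f u) = pi (f v).
Proof.
move=> fM f1 f2 u v /clsP Cuv; apply/clsP.
have [fe fV] := morph1V fM; rewrite -fV -fM.
move: (_ * _) Cuv; apply: smallest_sub.
  have [C1 CM CV] := generated_subgroup
    [set x | exists2 a, P2 a & exists2 b, P2op b & x = a * b * a^-1 * b^-1].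
  split=> [|x y /= Cx Cy|x /= Cx].
  - by rewrite /= fe.
  - by rewrite fM; apply: CM.
  - by rewrite fV; apply: CV.
move=> _ [a P2a [b P2b ->]] /=; apply: sub_gen_smallest.
by exists (f a); [apply: f1|exists (f b); [apply: f2|rewrite !fM !fV]].
Qed.

Lemma pi_El u v w : pi v = pi w -> pi (El u v) = pi (El u w).
Proof.
apply: comm_sub_morph; first exact: ElM.
- by move=> x Px; apply/(cls_eq1 N1); rewrite cls1_El; apply/cls_eq1.
- move=> x Px; apply/(cls_eq1 N2); rewrite cls2_El.
  by have /cls_eq1 -> : normal_set N2 x by []; rewrite conj1g.
Qed.

Lemma pi_Er u v w : pi u = pi w -> pi (Er v u) = pi (Er v w).
Proof.
apply: comm_sub_morph; first exact: ErM.
- by move=> x Px; apply/(cls_eq1 N1); rewrite cls1_Er; apply/cls_eq1.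
- move=> x Px; apply/(cls_eq1 N2); rewrite cls2_Er.
  by have /cls_eq1 -> : normal_set N2 x by []; rewrite conj1g.
Qed.

Lemma circ_Mr_mul u v m :
  circ_Mr (u * v) m = circ_Mr u m * (gen m)^-1 * circ_Mr v m.
Proof. by rewrite /circ_Mr fg_liftM !gnorm. Qed.

Lemma circ_Mr_gen l m : circ_Mr (gen l) m = gen (l * m).
Proof. by rewrite /circ_Mr fg_lift_gen !gnorm. Qed.

Lemma circ_l_gen u m : circ_l u (gen m) = circ_Mr u m.
Proof. by rewrite /circ_l fg_lift_gen !gnorm. Qed.

Lemma circ_r_gen m v : circ_r (gen m) v = circ_Ml m v.
Proof. by rewrite /circ_r fg_lift_gen !gnorm. Qed.

Lemma circ_l_Ml m v : circ_l (gen m) v = circ_Ml m v.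
Proof.
congr (_ * _); apply: eq_bigr => -[l []] _; by rewrite /signed /= circ_Mr_gen.
Qed.

Lemma circ_lM u v w : circ_l u (v * w) = circ_l u v * u^-1 * circ_l u w.
Proof. by rewrite /circ_l fg_liftM !gnorm. Qed.

Lemma pi_circ_lM u u' v :
  pi (circ_l (u * u') v) = pi (circ_l u v) * (pi v)^-1 * pi (circ_l u' v).
Proof.
rewrite /circ_l -!/(El _ _) !piM.
suff -> : pi (El (u * u') v) =
    (pi u')^-1 * pi (El u v) * (pi v)^-1 * pi u' * pi (El u' v).
  by rewrite !gnorm.
move: v; apply: fg_ext => [v w|v w|m].
- by rewrite ElM piM.
- rewrite !ElM !piM invgM.
  have := @pi_commute (El u w * w^-1) (v^-1 * (u' * (El u' v * u'^-1))).
  rewrite !clsM !clsV cls1_El cls2_El /conjg !gnorm => /(_ erefl erefl).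
  rewrite !piM !piV !gnorm => E.
  rewrite -!mulgA; congr (_ * (_ * _)).
  rewrite !mulgA.
  by rewrite -E !gnorm.
- rewrite /El !fg_lift_gen circ_Mr_mul !piM !piV !piM.
  by rewrite !gnorm.
Qed.

Lemma pi_circ_lr u v : pi (circ_l u v) = pi (circ_r u v).
Proof.
apply: (mulIg (pi v)^-1); move: u; apply: fg_ext => [u w|u w|m].
- by rewrite pi_circ_lM !gnorm.
- by rewrite /circ_r fg_liftM !piM !gnorm.
- by rewrite circ_l_Ml circ_r_gen.
Qed.

Lemma pi_circ_l u u' v v' : pi u = pi u' -> pi v = pi v' ->
  pi (circ_l u v) = pi (circ_l u' v').
Proof.
move=> uu' vv'; rewrite /circ_l piM -/(El u v) (pi_El u vv') -piM.
rewrite -/(circ_l u v') !pi_circ_lr /circ_r !piM; congr (_ * _).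
exact: pi_Er.
Qed.

Lemma fw_circE u v :
  fw_circ (fw_class u) (fw_class v) = fw_class (circ_l u v).
Proof. by apply: pi_circ_l; apply: cls_repr. Qed.

Lemma fw_circEr u v :
  fw_circ (fw_class u) (fw_class v) = fw_class (circ_r u v).
Proof. by rewrite fw_circE pi_circ_lr. Qed.

Lemma fw_circMr p q r :
  fw_circ p (q * r) = fw_circ p q * p^-1 * fw_circ p r.
Proof.
elim/pi_ind: p => u; elim/pi_ind: q => v; elim/pi_ind: r => w.
by rewrite -piM !fw_circE circ_lM !piM piV.
Qed.

Lemma fw_circMl p q r :
  fw_circ (q * r) p = fw_circ q p * p^-1 * fw_circ r p.
Proof.
elim/pi_ind: p => u; elim/pi_ind: q => v; elim/pi_ind: r => w.
by rewrite -piM !fw_circE pi_circ_lM.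
Qed.

Lemma fw_circ1 p : fw_circ p 1 = p.
Proof.
have := fw_circMr p 1 1; rewrite mulg1 -mulgA => /esym.
by rewrite -[X in _ = X]mulg1 => /mulgI/mulg1_eq; rewrite invgK.
Qed.

Lemma fw_1circ p : fw_circ 1 p = p.
Proof.
have := fw_circMl p 1 1; rewrite mulg1 => /esym.
rewrite -[X in _ = X]mul1g => /mulIg /divg1_eq //.
Qed.

Lemma fw_circVr p q : fw_circ p q^-1 = p * (fw_circ p q)^-1 * p.
Proof.
apply: (mulgI (fw_circ p q * p^-1)).
by rewrite -fw_circMr mulgV fw_circ1 !gnorm.
Qed.

Lemma fw_circVl p q : fw_circ q^-1 p = p * (fw_circ q p)^-1 * p.
Proof.
apply: (mulgI (fw_circ q p * p^-1)).
by rewrite -fw_circMl mulgV fw_1circ !gnorm.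
Qed.

Lemma fw_circA : associative fw_circ.
Proof.
move=> p q; elim/pi_ind => w.
apply: (mulgI (fw_circ p q)^-1).
move: w; apply: fg_ext => [w w'|w w'|n].
- by rewrite piM !fw_circMr fw_circVr !gnorm.
- by rewrite piM !fw_circMr !gnorm.
congr (_ * _); elim/pi_ind: p => u.
apply: (mulIg (fw_circ q (pi (gen n)))^-1).
move: u; apply: fg_ext => [u u'|u u'|m].
- by rewrite piM !fw_circMl !gnorm.
- by rewrite piM !fw_circMl fw_circVl !gnorm.
congr (_ * _); elim/pi_ind: q => v.
apply: (mulIg (fw_circ (pi (gen m)) (pi (gen n)))^-1).
move: v; apply: fg_ext => [v v'|v v'|l].
- by rewrite piM fw_circMl !fw_circMr fw_circVr !gnorm.
- by rewrite piM fw_circMr !fw_circMl fw_circVl !gnorm.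
by rewrite !(fw_circE, circ_l_gen, circ_Mr_gen) mulgA.
Qed.

HB.instance Definition _ := Group_isWire.Build Fw fw_circA fw_circMr fw_circMl.

End FreeWire.

Arguments fw_iota {X} x.

(* Main.v *)
Require Import Defs.
From HB Require Import structures.
From mathcomp Require Import all_boot perm boolp classical_sets.

(* A map [f : X -> W] extends along [\circ] to words and then multiplicatively
   to [P(X)]. Expanding [(u * u') \circ (v * v')] with the two distributive laws
   in either order shows that [v^-1 * (u' \circ v) * u'^-1] and
   [u^-1 * (u \circ v') * v'^-1] always commute in a wire, so the extension kills
   [[P(X)^2, P(X)^2_op]]. Injectivity of [iota] follows by separating points
   with maps to a group of order two, every group being a wire with both
   operations equal. *)

Set Implicit Arguments.
Unset Strict Implicit.
Unset Printing Implicit Defensive.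

Local Open Scope group_scope.

(** An alias, so that taking [\circ] to be [*] is not imposed on [G] itself. *)
Definition group_wire (G : groupType) : Type := G.

HB.instance Definition _ (G : groupType) := Group.on (group_wire G).

Section GroupWire.
Variable G : groupType.
Implicit Types a b c : group_wire G.

Lemma group_wireMr a b c : a * (b * c) = a * b * a^-1 * (a * c).
Proof. by rewrite !gnorm. Qed.

Lemma group_wireMl a b c : b * c * a = b * a * a^-1 * (c * a).
Proof. by rewrite !gnorm. Qed.

HB.instance Definition _ :=
  Group_isWire.Build (group_wire G) (@mulgA G) group_wireMr group_wireMl.

End GroupWire.

(** * Commutation relations valid in every wire *)

Section WireCommutation.
Variable W : wireType.
Implicit Types a b m l u v y : W.

Definition defect m l : W := m^-1 * (m \circ l) * l^-1.
Definition defect_op m l : W := m^-1 * (l \circ m) * l^-1.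

Lemma commute_defect u u' v v' : commute (defect u v') (defect_op v u').
Proof.
(* These outer factors complete both sides to the two expansions of [(u * u') \circ (v * v')]. *)
apply: (mulgI (u \circ v)); apply: (mulIg (u' \circ v')).
have := circMl (v * v') u u'; rewrite !circMr !circMl !invgM /defect /defect_op.
by rewrite !gnorm => ->.
Qed.

(* [l |-> m^-1 * (m \circ l)] is a group endomorphism. *)
Lemma defectJ m l y : defect m l ^ y = (defect m y^-1)^-1 * defect m (y^-1 * l).
Proof. by rewrite /defect circMr /conjg !(invgM, invgK) !gnorm. Qed.

(** Conjugating [a] amounts to conjugating the opposite defects, so this is the centraliser of their
    normal closure. *)
Definition centraliser_op a : Prop :=
  forall y m l, commute (a ^ y) (defect_op m l).

Lemma centraliser_op_normal : is_normal_subgroup centraliser_op.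
Proof.
split; first split.
- by move=> y m l; rewrite conj1g; apply/commute_sym/commute1.
- move=> a b Ca Cb y m l; rewrite conjMg; apply/commute_sym/commuteM.
    exact/commute_sym/Ca.
  exact/commute_sym/Cb.
- by move=> a Ca y m l; rewrite conjVg; apply/commute_sym/commuteV/commute_sym/Ca.
- by move=> a z Ca y m l; rewrite -conjgM; apply: Ca.
Qed.

(** By [defectJ], conjugates of defects are products of defects and their inverses, so
    [commute_defect] covers them. *)
Lemma centraliser_op_defect m l : centraliser_op (defect m l).
Proof.
move=> y m' l'; rewrite defectJ; apply/commute_sym/commuteM.
  exact/commuteV/commute_sym/commute_defect.
exact/commute_sym/commute_defect.
Qed.

(** The double centraliser inherits normality from [centraliser_op], so no conjugation formula for
    [defect_op] is required. *)
Definition bicentraliser_op b : Prop :=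
  forall a, centraliser_op a -> commute a b.

Lemma bicentraliser_op_normal : is_normal_subgroup bicentraliser_op.
Proof.
have [_ nC] := centraliser_op_normal.
split; first split.
- by move=> a _; apply: commute1.
- by move=> b c Cb Cc a Ca; apply: commuteM; [apply: Cb|apply: Cc].
- by move=> b Cb a Ca; apply/commuteV/Cb.
- move=> b y Cb a Ca; have := Cb _ (nC _ y^-1 Ca).
  by move=> /(congr1 (conjg^~ y)) /=; rewrite [LHS]conjMg [RHS]conjMg conjgKV.
Qed.

Lemma bicentraliser_op_defect m l : bicentraliser_op (defect_op m l).
Proof. by move=> a /(_ 1 m l); rewrite conjg1. Qed.

End WireCommutation.

Lemma preimage_normal_subgroup (G H : groupType) (h : G -> H) (A : set H) :
    {morph h : x y / x * y} -> is_normal_subgroup A ->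
  is_normal_subgroup [set x | A (h x)]%classic.
Proof.
move=> hM [[A1 AM AV] AJ]; have [h1 hV] := morph1V hM.
split; first split=> /=.
- by rewrite h1.
- by move=> x y Ax Ay; rewrite hM; apply: AM.
- by move=> x Ax; rewrite hV; apply: AV.
- by move=> x y Ax; rewrite /= /conjg !hM hV; apply: AJ.
Qed.

(** * Extension of a map to the free wire *)

Section Extension.
Variables (X : Type) (W : wireType) (f : X -> W).

Local Notation M := (free_semigroup X).
Local Notation P := (free_group M).
Implicit Types (m l : M) (u v : P).

Definition word_lift m : W :=
  foldl (fun a x => a \circ f x) (f (first_letter m)) (tail m).

Lemma word_liftM m l : word_lift (m * l) = word_lift m \circ word_lift l.
Proof.
case: m l => [x s] [y t]; rewrite /word_lift /= foldl_cat /=.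
(* [foldl] nests to the left, so the last letter is the outermost factor. *)
elim/last_ind: t => [//|t z IHt].
by rewrite -!cats1 !foldl_cat /= IHt circA.
Qed.

Definition fg_ext_lift : P -> W := fg_lift word_lift.

Lemma fg_ext_liftM : {morph fg_ext_lift : u v / u * v}.
Proof. exact: fg_liftM. Qed.

Lemma fg_ext_liftV : {morph fg_ext_lift : u / u^-1}.
Proof. by have [] := morph1V fg_ext_liftM. Qed.

Lemma fg_ext_lift_gen m : fg_ext_lift (gen m) = word_lift m.
Proof. exact: fg_lift_gen. Qed.

(** After right multiplication by the inverse of [word_lift m], both sides are homomorphisms in [u],
    so generators suffice. *)
Lemma fg_ext_lift_Mr u m :
  fg_ext_lift (circ_Mr u m) = fg_ext_lift u \circ word_lift m.
Proof.
rewrite fg_ext_liftM fg_ext_lift_gen.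
apply: (mulIg (word_lift m)^-1); rewrite mulgK.
move: u; apply: fg_ext => [u v|u v|l].
- by rewrite fg_liftM fg_ext_liftM.
- by rewrite fg_ext_liftM circMl !mulgA.
by rewrite fg_lift_gen fg_ext_liftM fg_ext_liftV !fg_ext_lift_gen word_liftM.
Qed.

Lemma fg_ext_lift_circ u v :
  fg_ext_lift (circ_l u v) = fg_ext_lift u \circ fg_ext_lift v.
Proof.
rewrite fg_ext_liftM.
apply: (mulgI (fg_ext_lift u)^-1); rewrite mulKg.
move: v; apply: fg_ext => [v w|v w|m].
- by rewrite fg_liftM fg_ext_liftM.
- by rewrite fg_ext_liftM circMr !mulgA.
by rewrite fg_lift_gen fg_ext_liftM fg_ext_liftV fg_ext_lift_Mr fg_ext_lift_gen.
Qed.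

(** The preimage of a normal subgroup is normal, so only the generators of [P2] matter; they map to
    defects. *)
Lemma fg_ext_lift_P2 u : P2 u -> centraliser_op (fg_ext_lift u).
Proof.
move: u; apply: smallest_sub.
  exact: preimage_normal_subgroup fg_ext_liftM (centraliser_op_normal W).
move=> _ [m [l ->]] /=.
rewrite !fg_ext_liftM !fg_ext_liftV !fg_ext_lift_gen word_liftM.
exact: centraliser_op_defect.
Qed.

Lemma fg_ext_lift_P2op u : P2op u -> bicentraliser_op (fg_ext_lift u).
Proof.
move: u; apply: smallest_sub.
  exact: preimage_normal_subgroup fg_ext_liftM (bicentraliser_op_normal W).
move=> _ [m [l ->]] /=.
rewrite !fg_ext_liftM !fg_ext_liftV !fg_ext_lift_gen word_liftM.
exact: bicentraliser_op_defect.
Qed.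

Lemma fg_ext_lift_comm u : normal_set (P2_comm X) u -> fg_ext_lift u = 1.
Proof.
have [h1 hV] := morph1V fg_ext_liftM.
move: u; apply: smallest_sub => /=.
  split=> [|x y /= hx hy|x /= hx] //=.
  - by rewrite fg_ext_liftM hx hy mulg1.
  - by rewrite fg_ext_liftV hx invg1.
move=> _ [a /fg_ext_lift_P2 Pa [b /fg_ext_lift_P2op/(_ _ Pa) Cab ->]] /=.
by rewrite !fg_ext_liftM !fg_ext_liftV Cab mulgK mulgV.
Qed.

Definition fw_lift (q : Fw X) : W := fg_ext_lift (repr q).

Lemma fw_liftE u : fw_lift (fw_class u) = fg_ext_lift u.
Proof.
have /clsP/fg_ext_lift_comm := cls_repr (fw_class u).
rewrite fg_ext_liftM fg_ext_liftV => /(canRL (mulVKg _)).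
by rewrite mulg1 => ->.
Qed.

Lemma fw_lift_morphism : wire_morphism fw_lift.
Proof.
split=> p q; elim/quot_ind: p => u; elim/quot_ind: q => v.
  by rewrite -clsM !fw_liftE fg_ext_liftM.
by rewrite [_ \circ _]fw_circE !fw_liftE fg_ext_lift_circ.
Qed.

Lemma fw_lift_iota x : fw_lift (fw_iota x) = f x.
Proof. by rewrite fw_liftE fg_ext_lift_gen. Qed.

End Extension.

(** * Uniqueness of the extension and injectivity *)

Lemma fw_class_genM (X : Type) (m l : free_semigroup X) :
  fw_class (gen (m * l)) = fw_class (gen m) \circ fw_class (gen l).
Proof. by rewrite [RHS]fw_circE circ_l_gen circ_Mr_gen. Qed.

(** Letters generate words under [\circ], and classes of words generate [Fw X] as a group. *)
Lemma fw_morphism_ext (X : Type) (W : wireType) (g h : Fw X -> W) :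
    wire_morphism g -> wire_morphism h ->
  (forall x, g (fw_iota x) = h (fw_iota x)) -> g =1 h.
Proof.
move=> [gM gC] [hM hC] gh; elim/quot_ind.
apply: fg_ext => [u v|u v|[x s]]; rewrite ?clsM //.
elim: s x => [|y s IHs] x; first exact: gh.
have -> : Word x (y :: s) = letter x * Word y s by [].
by rewrite -/(fw_class _) fw_class_genM gC hC [g _]gh [X in _ \circ X]IHs.
Qed.

Lemma fw_iota_inj (X : Type) : injective (@fw_iota X).
Proof.
move=> x y exy; apply: contrapT => nxy.
(* Any map extends, so it is enough that [f] tells [x] from [y]; the two permutations differ at
   [true]. *)
pose f z : group_wire {perm bool} :=
  if `[< z = x >] then 1 else tperm true false.
have := congr1 (fw_lift f) exy; rewrite !fw_lift_iota /f.
rewrite asboolT // asboolF => [/permP/(_ true)|/esym//].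
by rewrite perm1 tpermL.
Qed.

Theorem proposition3p18 (X : Type) :
  injective (@fw_iota X) /\
  forall (W : wireType) (f : X -> W),
    exists! fhat : Fw X -> W, wire_morphism fhat /\ fhat \o fw_iota = f.
Proof.
split=> [|W f]; first exact: fw_iota_inj.
exists (fw_lift f); split.
  split; first exact: fw_lift_morphism.
  by apply/funext => x; apply: fw_lift_iota.
move=> g [gP gf]; apply/funext.
apply: (fw_morphism_ext (fw_lift_morphism f) gP) => x.
by rewrite fw_lift_iota -gf.
Qed.
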